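(* Let $f=\frac1n\sum_{i=1}^n f_i$ where each $f_i:\mathbb{R}^d\to\mathbb{R}$ is $L_i$-smooth (not necessarily convex), $f$ is $L$-smooth, and $f$ satisfies the Polyak-Lojasiewicz condition with constant $\mu>0$: $$\|\nabla f(x)\|^2\ge2\mu(f(x)-f^* )\quad\text{for all }x\in\mathbb{R}^d.$$ Let $x^*$ be a minimizer of $f$ and $L_{\max}=\max_{1\le i\le n}L_i$. Then the iterates of SGD with constant step-size $\gamma_k=\gamma$, $0<\gamma\le\frac{\mu}{L_{\max}^2}$, satisfy, for all $k\ge0$, $$\mathbb{E}[f(x^k)-f(x^* )]\le\nu^k\,[f(x^0)-f(x^* )]+\frac{L\sigma^2\gamma}{2(1-\nu)c},\qquad\text{where } \nu=1-\mu\gamma,\quad c=\frac{L_{\max}}{2\mu}.$$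
   Context: Setting: $f(x)=\frac1n\sum_{i=1}^n f_i(x)$ is minimized over $\mathbb{R}^d$; the set $\mathcal{X}^*$ of minimizers of $f$ is nonempty and $f^*=f(x^* )$ is the minimum value. A function is $L$-smooth if it is differentiable with $L$-Lipschitz gradient. $L$ and $L_i$ denote the smoothness constants of $f$ and $f_i$, with $L\le L_{\max}$. For each $i$, $f_i^*:=\inf_x f_i(x)$, and it is assumed throughout that $\sigma^2:=\mathbb{E}_i[f_i(x^* )-f_i^*]=f(x^* )-\frac1n\sum_{i=1}^n f_i^*<\infty$ (so all $f_i^*$ are finite), where $x^*\in\mathcal{X}^*$. SGD with constant step-size $\gamma$: starting from a deterministic $x^0$, at each iteration $k$ an index $i\in\{1,\dots,n\}$ is drawn uniformly at random, independently of the past, and $x^{k+1}=x^k-\gamma\nabla f_i(x^k)$. *)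

(* Defs.v *)
From HB Require Import structures.
From mathcomp Require Import all_boot all_order all_algebra.
From mathcomp Require Import finmap.
From mathcomp Require Import all_classical all_reals all_analysis.
Import Order.TTheory GRing.Theory Num.Theory.
Import numFieldNormedType.Exports.

Set Implicit Arguments.
Unset Strict Implicit.
Unset Printing Implicit Defensive.

Local Open Scope classical_set_scope.
Local Open Scope ring_scope.

(* The library norm `|v| on 'rV[R]_d is the sup norm; smoothness constants and
   the Polyak-Lojasiewicz condition are relative to the Euclidean one. The
   topology, hence differentiability, is the same for both. *)
Definition norm2 (R : realType) (d : nat) (v : 'rV[R]_d) : R :=
  Num.sqrt (\sum_(j < d) v 0 j ^+ 2).

Definition gradient (R : realType) (d : nat) (g : 'rV[R]_d -> R)
    (x : 'rV[R]_d) : 'rV[R]_d :=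
  \row_(j < d) 'D_(delta_mx 0 j) g x.

Definition smooth (R : realType) (d : nat) (L : R) (g : 'rV[R]_d -> R) : Prop :=
  (forall x, differentiable g x) /\
  (forall x y, norm2 (gradient g x - gradient g y) <= L * norm2 (x - y)).

Definition minimizer (R : realType) (d : nat) (g : 'rV[R]_d -> R)
    (x : 'rV[R]_d) : Prop :=
  forall y, g x <= g y.

Definition polyak_lojasiewicz (R : realType) (d : nat) (mu gstar : R)
    (g : 'rV[R]_d -> R) : Prop :=
  forall x, 2 * mu * (g x - gstar) <= norm2 (gradient g x) ^+ 2.

(* A finite sum has n.+1 >= 1 components, indexed by 'I_n.+1. *)
Definition average (R : realType) (n : nat) (a : 'I_n.+1 -> R) : R :=
  n.+1%:R^-1 * \sum_(i < n.+1) a i.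

Definition avg_fun (R : realType) (d n : nat) (f : 'I_n.+1 -> 'rV[R]_d -> R)
    (x : 'rV[R]_d) : R :=
  average (fun i => f i x).

Definition max_const (R : realType) (n : nat) (L : 'I_n.+1 -> R) : R :=
  \big[Num.max/L ord0]_(i < n.+1) L i.

(* [inf] is the genuine infimum only for functions bounded below. *)
Definition sigma2 (R : realType) (d n : nat) (f : 'I_n.+1 -> 'rV[R]_d -> R)
    (xstar : 'rV[R]_d) : R :=
  average (fun i => f i xstar - inf (range (f i))).

(* Measurability of every preimage amounts to measurability for the discrete
   sigma-algebra on the finite type of indices. *)
Definition iid_uniform (disp : measure_display) (T : measurableType disp)
    (R : realType) (P : probability T R) (n : nat)
    (I : nat -> T -> 'I_n.+1) : Prop :=
  [/\ forall (k : nat) (A : set 'I_n.+1), measurable (I k @^-1` A),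
      forall (k : nat) (i : 'I_n.+1),
        P (I k @^-1` [set i]) = (n.+1%:R^-1)%:E &
      forall (J : {fset nat}) (A : nat -> set 'I_n.+1),
        P (\bigcap_(k in [set` J]) (I k @^-1` A k)) =
        (\prod_(k <- J) P (I k @^-1` A k))%E].

Fixpoint sgd (R : realType) (d n : nat) (f : 'I_n.+1 -> 'rV[R]_d -> R)
    (gamma : R) (x0 : 'rV[R]_d) (T : Type) (I : nat -> T -> 'I_n.+1)
    (k : nat) (w : T) : 'rV[R]_d :=
  if k is k'.+1 then
    let x := sgd f gamma x0 I k' w in x - gamma *: gradient (f (I k' w)) x
  else x0.

(* Main.v *)
(* Write g = f - min f, M = L_max, and (Q h)(x) for the average over i of
   h(x - gamma grad f_i(x)), so that E[g(x^k)] = (Q^k g)(x^0).  The descent lemma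
   for f_i bounds |grad f_i(x)|^2 by 2 M (f_i(x) - inf f_i), whose average is
   2 M (g(x) + sigma^2); the descent lemma for f and the PL inequality then give
     Q g <= (1 - 2 mu gamma + L M gamma^2) g + L M gamma^2 sigma^2.
   As L M gamma <= M^2 gamma <= mu, this is at most nu g + (1 - nu) C with C the
   error term of the theorem, and Q^k g <= nu^k (g - C) + C follows. *)
Require Import Defs.
From HB Require Import structures.
From mathcomp Require Import all_boot all_order all_algebra.
From mathcomp Require Import finmap.
From mathcomp Require Import all_classical all_reals all_analysis.
From mathcomp Require Import measurable_realfun ring lra.
Import Order.TTheory GRing.Theory Num.Theory.
Import numFieldNormedType.Exports.

Local Open Scope classical_set_scope.
Local Open Scope ring_scope.

(** * Euclidean inner product and norm *)

Definition dot {R : realType} {d : nat} (u v : 'rV[R]_d) : R :=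
  \sum_(j < d) u 0 j * v 0 j.

Section Dot.
Context {R : realType} {d : nat}.
Implicit Types u v w : 'rV[R]_d.

Lemma dotC u v : dot u v = dot v u.
Proof. by apply: eq_bigr => j _; rewrite mulrC. Qed.

Lemma dotBl u v w : dot (u - v) w = dot u w - dot v w.
Proof.
by rewrite /dot -sumrB; apply: eq_bigr => j _; rewrite !mxE mulrBl.
Qed.

Lemma dotZl a u v : dot (a *: u) v = a * dot u v.
Proof. by rewrite /dot mulr_sumr; apply: eq_bigr => j _; rewrite !mxE mulrA. Qed.

Lemma dotZr a u v : dot u (a *: v) = a * dot u v.
Proof. by rewrite dotC dotZl dotC. Qed.

Lemma dotNr u v : dot u (- v) = - dot u v.
Proof. by rewrite -scaleN1r dotZr mulN1r. Qed.

Lemma dotvv u : dot u u = norm2 u ^+ 2.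
Proof.
rewrite /norm2 sqr_sqrtr; last by apply: sumr_ge0 => j _; exact: sqr_ge0.
by apply: eq_bigr => j _; rewrite expr2.
Qed.

Lemma norm2_ge0 u : 0 <= norm2 u.
Proof. exact: sqrtr_ge0. Qed.

Lemma norm2Z_sqr a u : norm2 (a *: u) ^+ 2 = a ^+ 2 * norm2 u ^+ 2.
Proof. by rewrite -!dotvv dotZl dotZr mulrA -expr2. Qed.

Lemma norm2Z a u : 0 <= a -> norm2 (a *: u) = a * norm2 u.
Proof.
move=> a0; apply: (pexpIrn (n := 2)); rewrite ?nnegrE ?norm2_ge0//.
  by rewrite mulr_ge0// norm2_ge0.
by rewrite norm2Z_sqr exprMn.
Qed.

Lemma norm2_eq0 u : norm2 u = 0 -> u = 0.
Proof.
move=> u0; have : dot u u = 0 by rewrite dotvv u0 expr0n.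
move/eqP; rewrite psumr_eq0; last by move=> j _; rewrite -expr2 sqr_ge0.
move=> /allP h; apply/rowP => j; rewrite mxE.
by have := h j (mem_index_enum j); rewrite /= mulf_eq0 orbb => /eqP.
Qed.

(** Cauchy-Schwarz: for [a = |u|] and [b = |v|] nonzero, expanding [|b u - a v|^2 >= 0] gives
    [2 a b (a b - dot u v) >= 0]. *)
Lemma dot_le_norm2 u v : dot u v <= norm2 u * norm2 v.
Proof.
have [u0|un0] := eqVneq (norm2 u) 0.
  rewrite (norm2_eq0 _ u0) /dot big1 ?mulr_ge0 ?norm2_ge0// => j _.
  by rewrite mxE mul0r.
have [v0|vn0] := eqVneq (norm2 v) 0.
  rewrite dotC (norm2_eq0 _ v0) /dot big1 ?mulr_ge0 ?norm2_ge0// => j _.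
  by rewrite mxE mul0r.
have u_gt0 : 0 < norm2 u by rewrite lt_def un0 norm2_ge0.
have v_gt0 : 0 < norm2 v by rewrite lt_def vn0 norm2_ge0.
have := sqr_ge0 (norm2 (norm2 v *: u - norm2 u *: v)).
rewrite -dotvv dotBl [X in _ <= X - _]dotC [X in _ <= _ - X]dotC !dotBl.
rewrite !(dotZl, dotZr) !dotvv (dotC v u).
set a := norm2 u in u_gt0 *; set b := norm2 v in v_gt0 *; set c := dot u v.
have ab : 0 < a * b by rewrite mulr_gt0.
move=> h; rewrite -(ler_pM2l ab); nra.
Qed.

End Dot.

(** * Descent inequalities for smooth functions *)

Section Smooth.
Context {R : realType} {d : nat}.
Implicit Types (g : 'rV[R]_d -> R) (x v y : 'rV[R]_d).

Lemma derive_dot g x v : differentiable g x -> 'D_v g x = dot (gradient g x) v.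
Proof.
move=> dg; rewrite deriveE// {1}(row_sum_delta v) linear_sum.
by apply: eq_bigr => j _; rewrite linearZ/= mxE deriveE// mulrC.
Qed.

Lemma is_derive_line g x v t : differentiable g (x + t *: v) ->
  is_derive t 1 (fun s : R => g (x + s *: v)) (dot (gradient g (x + t *: v)) v).
Proof.
move=> dg; have dv := diff_derivable (v := v) dg.
have E :
    (fun h : R => h^-1 *: (((fun s : R => g (x + s *: v)) \o shift t) (h *: 1)
      - g (x + t *: v))) =
    (fun h : R => h^-1 *: ((g \o shift (x + t *: v)) (h *: v) - g (x + t *: v))).
  apply/funext => h /=; congr (_ *: (g _ - _)).
  by rewrite [h *: 1]mulr1 scalerDl addrCA.
split; first by rewrite /derivable E.
by rewrite -derive_dot// /derive E.
Qed.

Lemma smooth_le {L L' : R} {g} : L <= L' -> smooth L g -> smooth L' g.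
Proof.
move=> LL' [dg lg]; split=> // x y; apply: le_trans (lg x y) _.
by rewrite ler_wpM2r// norm2_ge0.
Qed.

(** Monotonicity replaces integration along the segment: [phi], which is [g] on the segment minus
    the linear and quadratic terms, has derivative [dot (grad g (x + t v) - grad g x) v - L t
    |v|^2]. This is nonpositive by Cauchy-Schwarz and the Lipschitz bound, and [phi 1 <= phi 0] is
    the claim. *)
Lemma smooth_descent {L : R} {g} x v : smooth L g ->
  g (x + v) <= g x + dot (gradient g x) v + L / 2 * norm2 v ^+ 2.
Proof.
move=> [dg lg].
set a := dot (gradient g x) v; set b := L / 2 * norm2 v ^+ 2.
pose phi (t : R) := g (x + t *: v) - (a * t + b * t ^+ 2).
have dphi (t : R) : is_derive t 1 phi
      (dot (gradient g (x + t *: v)) v - (a + b * (2 * t))).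
  rewrite /phi; have h := is_derive_line _ _ _ _ (dg (x + t *: v)).
  apply: is_deriveB.
  have -> : (fun s : R => a * s + b * s ^+ 2) =
      (a \*: (@id R) + b \*: (@id R) ^+ 2 : R -> R).
    by apply/funext => s; rewrite exprfctE.
  by apply: is_derive_eq; rewrite /GRing.scale/=; ring.
have : phi 1 <= phi 0.
  apply: (ler0_derive1_nincr (a := 0) (b := 1)) => //.
  - move=> t; rewrite in_itv/= => /andP[t0 t1].
    rewrite derive1E derive_val.
    have -> : a + b * (2 * t) = a + L * t * norm2 v ^+ 2 by rewrite /b; field.
    rewrite opprD addrA subr_le0 -dotBl.
    apply: le_trans (dot_le_norm2 _ _) _.
    apply: le_trans (ler_wpM2r (norm2_ge0 _) (lg _ _)) _.
    by rewrite (addrC x) addrK norm2Z ?(ltW t0)// expr2 !mulrA.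
  - apply: continuous_subspaceT => t.
    apply: differentiable_continuous. by apply/derivable1_diffP; case: (dphi t).
rewrite /phi scale1r scale0r addr0; lra.
Qed.

(** The step [- L^-1 grad g x] minimizes the quadratic upper bound of the descent inequality, with
    value [g x - |grad g x|^2 / (2 L)]; this is still at least [m]. *)
Lemma smooth_norm_gradient_le {L : R} {g} x m : 0 < L -> smooth L g ->
  (forall y, m <= g y) -> norm2 (gradient g x) ^+ 2 <= 2 * L * (g x - m).
Proof.
move=> L0 sg gm.
have := smooth_descent x (- (L^-1 *: gradient g x)) sg.
have := gm (x - L^-1 *: gradient g x).
rewrite dotNr -scaleNr norm2Z_sqr sqrrN dotZr dotvv.
set G := _ ^+ 2; move=> h1 h2.
have {h1 h2} h := le_trans h1 h2.
have -> : G = 2 * L * (L^-1 * G - L / 2 * (L^-1 ^+ 2 * G)) by field; lra.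
rewrite ler_pM2l; last by rewrite mulr_gt0.
lra.
Qed.

End Smooth.

(** * Averages over the index set *)

Section Average.
Context {R : realType} {n : nat}.
Implicit Types a b : 'I_n.+1 -> R.

Lemma averageD a b : average (fun i => a i + b i) = average a + average b.
Proof. by rewrite /average big_split mulrDr. Qed.

Lemma averageB a b : average (fun i => a i - b i) = average a - average b.
Proof. by rewrite /average sumrB mulrBr. Qed.

Lemma averageZ (c : R) a : average (fun i => c * a i) = c * average a.
Proof. by rewrite /average -mulr_sumr mulrCA. Qed.

Lemma average_cst (c : R) : average (fun _ : 'I_n.+1 => c) = c.
Proof.
by rewrite /average sumr_const card_ord -[c *+ _]mulr_natl mulKf// pnatr_eq0.
Qed.

Lemma le_average a b : (forall i, a i <= b i) -> average a <= average b.
Proof. by move=> ab; rewrite ler_wpM2l ?invr_ge0// ler_sum. Qed.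

End Average.

(** * Unbiasedness of the stochastic gradient and the one-step estimate *)

Lemma dot_gradient_avg {R : realType} {d n : nat}
    (f : 'I_n.+1 -> 'rV[R]_d -> R) (u x : 'rV[R]_d) :
  (forall i y, differentiable (f i) y) ->
  dot u (gradient (avg_fun f) x) = average (fun i => dot u (gradient (f i) x)).
Proof.
move=> df; have df' i v : derivable (f i) x v by exact: diff_derivable.
have -> : gradient (avg_fun f) x = n.+1%:R^-1 *: \sum_i gradient (f i) x.
  apply/rowP => j; rewrite !mxE summxE.
  have -> : avg_fun f = n.+1%:R^-1 \*: (\sum_i f i : 'rV[R]_d -> R).
    by apply/funext => y; rewrite /avg_fun /average fct_sumE.
  rewrite deriveZ; last exact: derivable_sum.
  by rewrite derive_sum//; congr (_ * _); apply: eq_bigr => i _; rewrite mxE.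
rewrite dotZr; congr (_ * _); rewrite /dot exchange_big/=.
by apply: eq_bigr => j _; rewrite summxE mulr_sumr.
Qed.

Lemma average_sgd_step_le {R : realType} {d n : nat}
    (f : 'I_n.+1 -> 'rV[R]_d -> R) (L M mu gamma : R) (xstar x : 'rV[R]_d) :
  0 <= L -> L <= M -> 0 < M -> 0 <= gamma -> gamma <= mu / M ^+ 2 ->
  (forall i, smooth M (f i)) -> smooth L (avg_fun f) ->
  (forall i, has_lbound (range (f i))) -> minimizer (avg_fun f) xstar ->
  polyak_lojasiewicz mu (avg_fun f xstar) (avg_fun f) ->
  average (fun i => avg_fun f (x - gamma *: gradient (f i) x) - avg_fun f xstar)
  <= (1 - mu * gamma) * (avg_fun f x - avg_fun f xstar)
     + L * M * gamma ^+ 2 * sigma2 f xstar.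
Proof.
move=> L0 LM M0 g0 gle sf sF lb xmin PL.
set F := avg_fun f in sF xmin PL *; set G := gradient F x.
pose D i := f i x - inf (range (f i)).
have Dstar : average D = F x - F xstar + sigma2 f xstar.
  by rewrite /sigma2 /D !averageB -/(avg_fun f x) -/(avg_fun f xstar) -/F; ring.
have grad_le i : norm2 (gradient (f i) x) ^+ 2 <= 2 * M * D i.
  by apply: smooth_norm_gradient_le => // y; apply: ge_inf => //; exists y.
have step i : F (x - gamma *: gradient (f i) x) - F xstar <=
    (F x - F xstar) + (- gamma * dot G (gradient (f i) x)
      + L * M * gamma ^+ 2 * D i).
  have := smooth_descent x (- (gamma *: gradient (f i) x)) sF.
  rewrite dotNr dotZr -[in norm2 _]scaleNr norm2Z_sqr sqrrN => h.
  have := ler_wpM2l (mulr_ge0 L0 (sqr_ge0 gamma)) (grad_le i).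
  move: h; rewrite -/G.
  move: (F (x - _)) (F x) (F xstar) (dot _ _) (norm2 _ ^+ 2) (D i) => *; lra.
apply: le_trans (le_average _ _ step) _.
rewrite !averageD !average_cst !averageZ -dot_gradient_avg; last by
  move=> i y; case: (sf i).
rewrite dotvv Dstar -/G.
have PLx := PL x; rewrite -/G in PLx.
have Fx := xmin x.
(* The PL inequality yields a decrease of [2 mu gamma] times the gap; by [h3], half of it absorbs
   the part of the gradient noise proportional to the gap. *)
have h1 : gamma * (2 * mu * (F x - F xstar)) <= gamma * norm2 G ^+ 2.
  by rewrite ler_wpM2l.
(* The step-size bound enters here, as [gamma M^2 <= mu]. *)
have h2 : L * M * gamma ^+ 2 <= mu * gamma.
  have : gamma * M ^+ 2 <= mu by rewrite -ler_pdivlMr ?exprn_gt0.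
  have : L * M <= M ^+ 2 by rewrite expr2 ler_wpM2r// ltW.
  nra.
have h3 : L * M * gamma ^+ 2 * (F x - F xstar) <= mu * gamma * (F x - F xstar).
  by rewrite ler_wpM2r// subr_ge0.
move: (F x) (F xstar) (sigma2 _ _) (norm2 _ ^+ 2) h1 h3 => *; lra.
Qed.

(** * Expectations along the chain of iterates *)

Section Law.
Context {R : realType} {d n : nat} {disp : measure_display}.
Context {T : measurableType disp} {P : probability T R}.
Variables (f : 'I_n.+1 -> 'rV[R]_d -> R) (gamma : R) (x0 : 'rV[R]_d).
Variable I : nat -> T -> 'I_n.+1.
Hypothesis I_iid : iid_uniform P I.

Let sgd_step (i : 'I_n.+1) (x : 'rV[R]_d) := x - gamma *: gradient (f i) x.

(** Transition operator of the Markov chain of iterates, written [Q] in the opening comment. *)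
Definition sgd_operator (h : 'rV[R]_d -> R) (x : 'rV[R]_d) : R :=
  average (fun i => h (x - gamma *: gradient (f i) x)).

Lemma iter_sgd_operator_ge0 k h x : (forall y, 0 <= h y) ->
  0 <= iter k sgd_operator h x.
Proof.
move=> h0; elim: k x => //= k IH x.
by rewrite mulr_ge0 ?invr_ge0// sumr_ge0.
Qed.

Lemma iter_sgd_operator_average k (h : 'I_n.+1 -> 'rV[R]_d -> R) x :
  average (fun i => iter k sgd_operator (h i) x) =
  iter k sgd_operator (fun y => average (fun i => h i y)) x.
Proof.
elim: k x => //= k IH x; rewrite /sgd_operator -/sgd_operator /average.
rewrite -mulr_sumr exchange_big/=; congr (_ * _).
by rewrite mulr_sumr; apply: eq_bigr => i _; rewrite -IH.
Qed.

(** [C] is the fixed point of [t -> nu t + (1 - nu) C], so the excess over [C] contracts by [nu] at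
    each step; [nu >= 0] lets the one-step bound be multiplied by [nu ^+ k]. *)
Lemma iter_sgd_operator_le k (h : 'rV[R]_d -> R) (nu C : R) x : 0 <= nu ->
  (forall y, sgd_operator h y <= nu * h y + (1 - nu) * C) ->
  iter k sgd_operator h x <= nu ^+ k * (h x - C) + C.
Proof.
move=> nu0 hQ; elim: k x => [|k IH] x; first by rewrite expr0 mul1r subrK.
rewrite iterS; apply: le_trans (le_average _ _ (fun i => IH _)) _.
rewrite averageD averageZ averageB !average_cst lerD2r exprSr -mulrA.
rewrite ler_wpM2l ?exprn_ge0//; have := hQ x; rewrite /sgd_operator; lra.
Qed.

(** The iterate depends on finitely many indices, each with finitely many values. Taking [A]
    arbitrary lets the induction pull it back through a step without any measurability of the
    gradients. *)
Lemma measurable_sgd_preimage k (A : set 'rV[R]_d) :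
  measurable (sgd f gamma x0 I k @^-1` A).
Proof.
have [mI _ _] := I_iid.
elim: k A => [|k IH] A.
  by have [xA|xA] := pselect (A x0); [rewrite preimage_cst ?mem_set|
     rewrite preimage_cst memNset].
have -> : sgd f gamma x0 I k.+1 @^-1` A =
    \big[setU/set0]_(i <- index_enum 'I_n.+1)
      (I k @^-1` [set i] `&` sgd f gamma x0 I k @^-1` (sgd_step i @^-1` A)).
  rewrite -bigcup_seq; apply/seteqP; split=> [w Aw|w [i _ [/= <-]]//].
  by exists (I k w); rewrite /= ?mem_index_enum.
by apply: bigsetU_measurable => i _; apply: measurableI.
Qed.

Lemma measurable_sgd_comp (D : set T) k (h : 'rV[R]_d -> R) :
  measurable_fun D (EFin \o (fun w => h (sgd f gamma x0 I k w))).
Proof.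
move=> mD Y mY; apply: measurableI => //.
exact: (measurable_sgd_preimage k ((EFin \o h) @^-1` Y)).
Qed.

(* Independence enters by restricting to events on the indices drawn at step [k]
   or later: conditioning on the index of step [k] keeps this shape. *)
Lemma integral_sgd_future k (h : 'rV[R]_d -> R) (J : {fset nat})
    (A : nat -> set 'I_n.+1) :
  (forall x, 0 <= h x) -> (forall j, j \in J -> (k <= j)%N) ->
  (\int[P]_(w in \bigcap_(j in [set` J]) (I j @^-1` A j))
     (h (sgd f gamma x0 I k w))%:E =
   P (\bigcap_(j in [set` J]) (I j @^-1` A j)) *
     (iter k sgd_operator h x0)%:E)%E.
Proof.
have [mI PI indep] := I_iid.
have mB (J' : {fset nat}) A' :
    measurable (\bigcap_(j in [set` J']) (I j @^-1` A' j)).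
  by apply: fin_bigcap_measurable => [|j _]; [exact: finite_fset|exact: mI].
elim: k h J A => [|k IH] h J A h0 kJ.
  by rewrite /= integral_cst// muleC.
set B := \bigcap_(_ in _) _.
(* [A' i] adds the constraint that the index of step [k] is [i]; the old constraints all concern
   later steps. *)
pose A' (i : 'I_n.+1) j := if j == k then [set i] else A j.
have kNJ : k \notin J by apply/negP => /kJ; rewrite ltnn.
have A'J i j : j \in J -> A' i j = A j.
  by move=> jJ; rewrite /A'; case: eqP => // jk; rewrite -jk jJ in kNJ.
pose B' i := \bigcap_(j in [set` (k |` J)%fset]) (I j @^-1` A' i j).
have B'E i : B' i = I k @^-1` [set i] `&` B.
  rewrite /B' bigcap_fsetU1 {1}/A' eqxx; congr (_ `&` _).
  by apply: eq_bigcapr => j /= jJ; rewrite A'J.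
have PB' i : P (B' i) = (n.+1%:R^-1%:E * P B)%E.
  rewrite /B' indep big_fsetU1//= {1}/A' eqxx PI /B indep; congr (_ * _)%E.
  by apply: eq_big_seq => j jJ; rewrite A'J.
(* The events [B' i] partition [B] by the index of step [k]. *)
have BE : B = \big[setU/set0]_(i <- index_enum 'I_n.+1) B' i.
  rewrite -bigcup_seq; apply/seteqP; split=> [w Bw|w [i _]].
    by exists (I k w); rewrite /= ?mem_index_enum// B'E.
  by rewrite B'E => -[].
rewrite {1}BE ge0_integral_bigsetU//=.
- rewrite (eq_bigr (fun i => P B * (n.+1%:R^-1 *
    iter k sgd_operator (h \o sgd_step i) x0)%:E)%E); last first.
    move=> i _; rewrite EFinM muleA (muleC (P B)) -(PB' i).
    (* On [B' i] the last step is the fixed map [sgd_step i], so it can be moved into the test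
       function. *)
    rewrite -(IH (h \o sgd_step i) (k |` J)%fset (A' i)); first last.
    - by move=> j; rewrite !inE => /predU1P[->//|/kJ/ltnW].
    - by move=> x; exact: h0.
    by apply: eq_integral => w; rewrite inE -/(B' i) B'E => -[/= <- _].
  rewrite -ge0_sume_distrr; last first.
    move=> i _; rewrite lee_fin mulr_ge0 ?invr_ge0//.
    by apply: iter_sgd_operator_ge0 => y; exact: h0.
  rewrite sumEFin -mulr_sumr -/(average _).
  by rewrite iter_sgd_operator_average -iterS iterSr.
- by move=> i; exact: mB.
- exact: index_enum_uniq.
- move=> i j _ _ [w []]; rewrite !B'E => -[/= <- _] [/= <- _] //.
- exact: (measurable_sgd_comp _ k.+1 h).
- by move=> w _; rewrite lee_fin.
Qed.

Lemma expectation_sgd k (h : 'rV[R]_d -> R) : (forall x, 0 <= h x) ->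
  ('E_P[(fun w => h (sgd f gamma x0 I k w))%R] =
   (iter k sgd_operator h x0)%:E)%E.
Proof.
move=> h0; rewrite unlock.
(* With no constraint the event is the whole space. *)
have := @integral_sgd_future k h fset0 (fun=> setT) h0.
by rewrite set_fset0 bigcap_set0 probability_setT mul1e; apply.
Qed.

End Law.

(** * Signs of the constants and the final bound *)

Lemma smooth_const_ge0 {R : realType} {d : nat} (L : R) (g : 'rV[R]_d.+1 -> R) :
  smooth L g -> 0 <= L.
Proof.
move=> [_ lg]; pose e : 'rV[R]_d.+1 := delta_mx 0 0.
have e_gt0 : 0 < norm2 (e - 0).
  rewrite lt_def norm2_ge0 andbT; apply/eqP => /norm2_eq0/rowP/(_ 0).
  by rewrite !mxE eqxx subr0 => /eqP; rewrite oner_eq0.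
by rewrite -(pmulr_lge0 _ e_gt0) (le_trans _ (lg _ _))// norm2_ge0.
Qed.

Lemma sigma2_ge0 {R : realType} {d n : nat} (f : 'I_n.+1 -> 'rV[R]_d -> R) x :
  (forall i, has_lbound (range (f i))) -> 0 <= sigma2 f x.
Proof.
move=> lb; rewrite mulr_ge0 ?invr_ge0// sumr_ge0// => i _.
by rewrite subr_ge0; apply: ge_inf => //; exists x.
Qed.

Theorem corollary3p7 (R : realType) (d n : nat)
    (f : 'I_n.+1 -> 'rV[R]_d -> R) (Li : 'I_n.+1 -> R) (L mu gamma : R)
    (xstar x0 : 'rV[R]_d)
    (disp : measure_display) (T : measurableType disp) (P : probability T R)
    (I : nat -> T -> 'I_n.+1)
    (f_smooth : forall i, smooth (Li i) (f i))
    (avg_smooth : smooth L (avg_fun f))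
    (L_le_Lmax : L <= max_const Li)
    (f_lbound : forall i, has_lbound (range (f i)))
    (xstar_min : minimizer (avg_fun f) xstar)
    (mu_gt0 : 0 < mu)
    (avg_PL : polyak_lojasiewicz mu (avg_fun f xstar) (avg_fun f))
    (gamma_gt0 : 0 < gamma)
    (gamma_le : gamma <= mu / max_const Li ^+ 2)
    (I_iid : iid_uniform P I) :
  let nu : R := 1 - mu * gamma in
  let c : R := max_const Li / (2 * mu) in
  forall k : nat,
    ('E_P[(fun w => avg_fun f (sgd f gamma x0 I k w) - avg_fun f xstar)%R] <=
     (nu ^+ k * (avg_fun f x0 - avg_fun f xstar)
      + L * sigma2 f xstar * gamma / (2 * (1 - nu) * c))%:E)%E.
Proof.
move=> nu c k.
set M := max_const Li in L_le_Lmax gamma_le c *.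
set g := fun x => avg_fun f x - avg_fun f xstar.
(* Division by zero gives 0, so [M = 0] would force [gamma <= 0]. *)
have M_neq0 : M != 0.
  apply/eqP => M0; move: gamma_le.
  by rewrite M0 expr0n invr0 mulr0 leNgt gamma_gt0.
(* In dimension 0 the Lipschitz constants may be negative. *)
case: d => [|d] in f xstar x0 f_smooth avg_smooth f_lbound xstar_min avg_PL g *.
  (* The space is a single point: the gap and [sigma2] vanish, and both sides are 0. *)
  have const (h : 'rV[R]_0 -> R) y : h y = h xstar.
    by rewrite (thinmx0 y) (thinmx0 xstar).
  rewrite [X in ('E_P[X] <= _)%E](_ : _ = cst 0); last first.
    by apply/funext => w /=; rewrite (const (avg_fun f) (sgd _ _ _ _ _ _)) subrr.
  rewrite expectation_cst lee_fin (const (avg_fun f) x0) subrr.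
  rewrite /sigma2 /average big1 ?(mulr0, mul0r, addr0)// => i _.
  rewrite (_ : range (f i) = [set f i xstar]) ?inf1 ?subrr//.
  apply/seteqP; split=> [_ [y _ <-]|_ ->]; first exact: const.
  by exists xstar.
have L_ge0 := smooth_const_ge0 _ _ avg_smooth.
have M_gt0 : 0 < M by rewrite lt_def M_neq0 (le_trans L_ge0).
have f_smoothM i : smooth M (f i).
  by apply: smooth_le (f_smooth i); exact: le_bigmax.
have g_ge0 x : 0 <= g x by rewrite subr_ge0.
have s_ge0 := sigma2_ge0 f xstar f_lbound.
set C := L * _ * gamma / _.
have numu : 1 - nu = mu * gamma by rewrite /nu; ring.
have C_ge0 : 0 <= C.
  rewrite /C numu /c; apply: divr_ge0.
    exact: mulr_ge0 (mulr_ge0 L_ge0 s_ge0) (ltW gamma_gt0).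
  by rewrite ltW// mulr_gt0 ?mulr_gt0 ?invr_gt0 ?mulr_gt0.
rewrite (expectation_sgd f gamma x0 _ I_iid k g g_ge0) lee_fin.
(* The PL constant is at most M, hence nu >= 0, unless g vanishes identically. *)
have [nu_ge0|nu_lt0] := leP 0 nu; last first.
  have g0 x : g x = 0.
    apply/eqP; rewrite eq_le g_ge0 andbT leNgt; apply/negP => gx_gt0.
    (* At a point with [g x > 0], comparing this upper bound with PL gives [mu <= M], hence
       [mu gamma <= (mu / M)^2 <= 1], against [nu < 0]. *)
    have grad_le := smooth_norm_gradient_le x (avg_fun f xstar) M_gt0
      (smooth_le L_le_Lmax avg_smooth) xstar_min.
    have mu_le_M : mu <= M.
      have := le_trans (avg_PL x) grad_le.
      by rewrite -/(g x) ler_pM2r// ler_pM2l.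
    move: nu_lt0; rewrite /nu subr_lt0 ltNge.
    have -> // : mu * gamma <= 1.
    apply: le_trans (ler_wpM2l (ltW mu_gt0) gamma_le) _.
    rewrite mulrA -expr2 ler_pdivrMr ?exprn_gt0// mul1r.
    by rewrite ler_pXn2r// nnegrE ltW.
  apply: le_trans (_ : 0 <= _); last by rewrite -/(g x0) g0 mulr0 add0r.
  (* As [nu] is negative here, the contraction is applied with factor 0 and fixed point 0. *)
  have := iter_sgd_operator_le f gamma k g 0 0 x0 (lexx 0).
  rewrite g0 subrr !mulr0 !addr0; apply=> y.
  rewrite g0 mulr0 -[leRHS](average_cst (n := n)).
  by apply: le_average => i; rewrite g0.
apply: le_trans (_ : nu ^+ k * (g x0 - C) + C <= _); last first.
  by rewrite lerD2r ler_wpM2l ?exprn_ge0// gerBl.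
apply: iter_sgd_operator_le => // y.
apply: le_trans
  (average_sgd_step_le f L M mu gamma xstar y _ _ _ _ _ _ _ _ _ _) _ => //.
  exact: ltW.
rewrite lerD2l numu.
(* Since [(1 - nu) c = gamma M / 2], [C] equals [L sigma2 / M]. After factoring out
   [L sigma2 gamma], what remains is [gamma M <= mu / M], the step-size condition. *)
have -> : mu * gamma * C = L * sigma2 f xstar * gamma * (mu / M).
  rewrite /C numu /c; by field; rewrite ?M_neq0 ?lt0r_neq0.
have -> : L * M * gamma ^+ 2 * sigma2 f xstar =
    L * sigma2 f xstar * gamma * (gamma * M) by ring.
apply: ler_wpM2l.
  exact: mulr_ge0 (mulr_ge0 L_ge0 s_ge0) (ltW gamma_gt0).
by rewrite ler_pdivlMr// -mulrA -expr2 -ler_pdivlMr ?exprn_gt0.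
Qed.
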